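(* Let $H=(V,E)$ be an oriented hypergraph that has an algebraic spanning tree over the integers. Then, with integer coefficients, $\operatorname{Im}\delta^0$ is a direct summand of $C^1$.
   Context: An oriented hypergraph $H=(V,E)$ consists of a finite set $V$ and a set $E$ of ordered pairs $(A,B)$ of disjoint subsets of $V$, where $E$ never contains both $(A,B)$ and $(B,A)$. $C_0,C_1$ are the free $\mathbb Z$-modules with bases $V,E$; $\partial_1\colon C_1\to C_0$ is the linear extension of $(A,B)\mapsto\sum_{v\in B}v-\sum_{v\in A}v$; $C^0=\mathrm{Hom}(C_0,\mathbb Z)$, $C^1=\mathrm{Hom}(C_1,\mathbb Z)$; $\delta^0(\varphi)=\varphi\circ\partial_1$. $\gamma_1\colon C_1\to C^1$ with $\gamma_1(e)(e')=\delta_{ee'}$; $\langle\,,\rangle$ is the bilinear form on $C_1$ with $\langle e,e'\rangle=\delta_{ee'}$; $\mathcal C:=\operatorname{Ker}\partial_1$, $\mathcal B:=\gamma_1^{-1}(\operatorname{Im}\delta^0)$. $T\subseteq E$ is an algebraic spanning tree over the integers if (1) $\mathcal B$ has a $\mathbb Z$-basis $(x_t\mid t\in T)$ with $\langle x_t,t'\rangle=\delta_{tt'}$ for all $t,t'\in T$, and (2) $\mathcal C$ has a $\mathbb Z$-basis $(x_e\mid e\in E\setminus T)$ with $\langle x_e,e'\rangle=\delta_{ee'}$ for all $e,e'\in E\setminus T$. *)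

(* Defs.v *)
From HB Require Import structures.
From mathcomp Require Import all_boot all_order all_algebra.
From mathcomp Require Import classical_sets.

Set Implicit Arguments.
Unset Strict Implicit.
Unset Printing Implicit Defensive.

Import GRing.Theory.
Local Open Scope ring_scope.
Local Open Scope classical_set_scope.

(* The free Z-module on a finite type I is {ffun I -> int}. It is written with
   int^o, the integers as a module over themselves, so that it is a [vectType]
   over int and Z-linear maps can be taken in the library's type 'Hom. *)
Notation freeZ I := {ffun I -> int^o}.

Definition bvec (I : finType) (i : I) : freeZ I := [ffun j => (j == i)%:R].

Definition linsum (I : finType) (W : lmodType int) (f : I -> W) (c : freeZ I)
    : W :=
  \sum_i (c i : int) *: f i.

Lemma linsum_is_linear (I : finType) (W : lmodType int) (f : I -> W) :
  linear (linsum f).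
Proof.
move=> a c d; rewrite /linsum scaler_sumr -big_split /=.
by apply: eq_bigr => i _; rewrite !ffunE scalerDl scalerA.
Qed.

HB.instance Definition _ (I : finType) (W : lmodType int) (f : I -> W) :=
  GRing.isLinear.Build int (freeZ I) W *:%R (linsum f) (linsum_is_linear f).

(* The linear extension of a function given on basis elements. *)
Definition linext (I : finType) (W : vectType int) (f : I -> W)
    : 'Hom(freeZ I, W) :=
  linfun (linsum f).

Lemma linext_bvec (I : finType) (W : vectType int) (f : I -> W) (i : I) :
  linext f (bvec i) = f i.
Proof.
rewrite lfunE /= /linsum (bigD1 i) //= big1 ?addr0.
  by rewrite ffunE eqxx scale1r.
by move=> j nij; rewrite ffunE (negbTE nij) scale0r.
Qed.

Definition is_basis (M : lmodType int) (A : set M) (I : finType) (x : I -> M)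
    : Prop :=
  (forall c : I -> int, \sum_i c i *: x i = 0 -> forall i, c i = 0) /\
  A = [set y | exists c : I -> int, y = \sum_i c i *: x i].

Definition is_submodule (M : lmodType int) (A : set M) : Prop :=
  GRing.submod_closed (mem A).

Definition direct_summand (M : lmodType int) (A : set M) : Prop :=
  is_submodule A /\
  exists B : set M,
    [/\ is_submodule B,
        A `&` B = [set 0]
      & forall y, exists a b, [/\ A a, B b & y = a + b]].

(* Since a pair and its reverse are never both present, (set0, set0), which is
   its own reverse, is not an edge. *)
Record ohypergraph (V : finType) := OHypergraph {
  edges : {set {set V} * {set V}};
  edges_disjoint : forall A B, (A, B) \in edges -> [disjoint A & B]%B;
  edges_oriented : forall A B, ~~ (((A, B) \in edges) && ((B, A) \in edges))
}.

Section Chains.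
Variables (V : finType) (H : ohypergraph V).

Definition edge : finType := {e : {set V} * {set V} | e \in edges H}.

Definition chain0 : vectType int := freeZ V.
Definition chain1 : vectType int := freeZ edge.
Definition cochain0 : vectType int := 'Hom(chain0, int^o).
Definition cochain1 : vectType int := 'Hom(chain1, int^o).

Definition d1 : 'Hom(chain1, chain0) :=
  linext (fun e : edge =>
    \sum_(v in (val e).2) bvec v - \sum_(v in (val e).1) bvec v).

Definition delta0 (phi : cochain0) : cochain1 := (phi \o d1)%VF.

Definition gamma1 : 'Hom(chain1, cochain1) :=
  linext (fun e : edge =>
    linext (fun e' : edge => ((e == e')%:R : int^o)) : cochain1).

Definition form (c c' : chain1) : int := \sum_(e : edge) (c e : int) * c' e.

Definition cycle_module : set chain1 := [set c | d1 c = 0].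

Definition cut_module : set chain1 := gamma1 @^-1` range delta0.

Definition algebraic_spanning_tree (T : {set edge}) : Prop :=
  (exists x : {t | t \in T} -> chain1,
     is_basis cut_module x /\
     forall t t', form (x t) (bvec (val t')) = (t == t')%:R) /\
  (exists x : {e | e \in ~: T} -> chain1,
     is_basis cycle_module x /\
     forall e e', form (x e) (bvec (val e')) = (e == e')%:R).

End Chains.

(* Main.v *)
Require Import Defs.
From mathcomp Require Import all_boot all_order all_algebra.
From mathcomp Require Import classical_sets.

(* Under the isomorphism gamma1, the image of delta0 corresponds to the cut
   module, whose basis (x_t) is dual to the tree edges. Hence an element of the
   image is determined by its values on T, and these values can be prescribed
   arbitrarily: the cochains vanishing on T form a complement. *)

Set Implicit Arguments.
Unset Strict Implicit.
Unset Printing Implicit Defensive.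

Import GRing.Theory.
Local Open Scope ring_scope.
Local Open Scope classical_set_scope.

Lemma freeZ_bvec (I : finType) (c : freeZ I) : c = \sum_i (c i : int) *: bvec i.
Proof.
apply/ffunP => j; rewrite sum_ffunE (bigD1 j) //= big1 ?addr0.
  by rewrite !ffunE eqxx /GRing.scale /= mulr1.
by move=> i nij; rewrite !ffunE eq_sym (negbTE nij) scaler0.
Qed.

Lemma lfun_bvec_ext (I : finType) (W : vectType int) (f g : 'Hom(freeZ I, W)) :
  (forall i, f (bvec i) = g (bvec i)) -> f = g.
Proof.
move=> fg; apply/lfunP => c; rewrite (freeZ_bvec c) !linear_sum.
by apply: eq_bigr => i _; rewrite !linearZ /= fg.
Qed.

Section Gamma.
Variables (V : finType) (H : ohypergraph V).

Lemma form_bvec (c : chain1 H) e : Defs.form c (bvec e) = c e.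
Proof.
rewrite /Defs.form (bigD1 e) //= big1 ?addr0.
  by rewrite ffunE eqxx mulr1.
by move=> i nie; rewrite ffunE (negbTE nie) mulr0.
Qed.

Lemma gamma1_bvec (c : chain1 H) e : gamma1 H c (bvec e) = c e.
Proof.
rewrite lfunE /= /linsum sum_lfunE (bigD1 e) //= big1 ?addr0.
  by rewrite scale_lfunE linext_bvec eqxx /GRing.scale /= mulr1.
by move=> i nie; rewrite scale_lfunE linext_bvec (negbTE nie) scaler0.
Qed.

(** The preimage is explicit: the chain whose coefficients are the values of [psi] on the edges. It
    moves cochains back to chains, where the cut module lives. *)
Lemma gamma1_surj (psi : cochain1 H) :
  gamma1 H [ffun e => psi (bvec e)] = psi.
Proof. by apply: lfun_bvec_ext => e; rewrite gamma1_bvec ffunE. Qed.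

Lemma range_delta0_submodule : is_submodule (range (@delta0 V H)).
Proof.
split=> [|a u v].
  by rewrite inE; exists 0 => //; rewrite /delta0 comp_lfun0l.
rewrite !inE => -[p _ <-] [q _ <-]; exists (a *: p + q) => //.
by rewrite /delta0 comp_lfunDl comp_lfunZl.
Qed.

Lemma vanishing_submodule (T : {set edge H}) :
  is_submodule
    [set psi : cochain1 H | forall t, t \in T -> psi (bvec t) = 0].
Proof.
split=> [|a u v].
  by rewrite inE => t _; rewrite lfunE.
rewrite !inE => hu hv t tT.
by rewrite add_lfunE scale_lfunE hu // hv // scaler0 addr0.
Qed.

End Gamma.

Theorem theorem22 (V : finType) (H : ohypergraph V)
    (hT : exists T : {set edge H}, algebraic_spanning_tree T) :
  direct_summand (range (@delta0 V H)).
Proof.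
case: hT => T [[x [[_ cutE] x_dual]] _].
(* By the duality [x_dual], the coefficients of a combination of the [x s] are its values at the
   edges of [T]. *)
have coef (a : {t | t \in T} -> int) t :
    (\sum_s a s *: x s) (val t) = a t.
  rewrite sum_ffunE (bigD1 t) //= big1 ?addr0.
    by rewrite ffunE -form_bvec x_dual eqxx /GRing.scale /= mulr1.
  by move=> s nst; rewrite ffunE -form_bvec x_dual (negbTE nst) scaler0.
split; first exact: range_delta0_submodule.
exists [set psi : cochain1 H | forall t, t \in T -> psi (bvec t) = 0].
split; first exact: vanishing_submodule.
  apply/seteqP; split=> [psi [im_psi psi0]|_ ->] /=; last first.
    split; last by move=> t _; rewrite lfunE.
    by exists 0 => //; rewrite /delta0 comp_lfun0l.
  (* The chain corresponding to [psi] is a cut, so it expands in the basis [x]. *)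
  have : cut_module (H:=H) [ffun e => psi (bvec e)].
    by rewrite /cut_module /preimage /= gamma1_surj.
  rewrite cutE => -[a psiE]; rewrite -(gamma1_surj psi) psiE big1 ?linear0 //.
  (* By [coef], [a t] is the value of [psi] on an edge of [T], hence zero. *)
  move=> t _; rewrite -(coef a t) -psiE ffunE psi0 ?scale0r //.
  exact: valP.
(* By [coef], [y] is the cut that takes the values of [psi] on [T], so [psi - gamma1 H y] vanishes
   there. *)
move=> psi; pose y := \sum_s (psi (bvec (val s)) : int) *: x s.
have cut_y : cut_module (H:=H) y.
  by rewrite cutE; exists (fun s => psi (bvec (val s))).
(* Since the cut module is a preimage under [gamma1], [cut_y] says exactly that [gamma1 H y] lies in
   the image of [delta0]. *)
exists (gamma1 H y), (psi - gamma1 H y); split=> //; last by rewrite addrC subrK.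
move=> t tT; rewrite add_lfunE opp_lfunE gamma1_bvec.
by rewrite (coef _ (Sub t tT)) subrr.
Qed.
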